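(* A $\mathbb{C}$-Banach space $(E,\|\cdot\|)$ satisfies the strong maximum modulus principle if and only if it is strictly plurisubharmonic.
   Context: A holomorphic manifold is a set equipped with a holomorphic atlas whose charts have as target an open set in a complete $\mathbb{C}$-normable space (a topological $\mathbb{C}$-vector space whose topology can be defined by a norm, complete). A $\mathbb{C}$-Banach space $(E,\|\cdot\|)$ satisfies the strong maximum modulus principle if every holomorphic map $\eta$ from a connected holomorphic manifold $X$ to $E$ such that $\|\eta\|$ has a local maximum is constant. Let $\bar{\mathbb{D}}\subset\mathbb{C}$ be the closed unit disc; a map defined on $\bar{\mathbb{D}}$ is holomorphic if it extends to a holomorphic map on a neighbourhood of $\bar{\mathbb{D}}$. A $\mathbb{C}$-Banach space $E$ is strictly plurisubharmonic if every holomorphic map $\gamma:\bar{\mathbb{D}}\to E$ whose image is contained in the unit sphere is constant. *)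

(* Defs.v *)
(* Complex numbers are [R[i]] for a [R : realType]; norms take values in [R[i]]. *)
From HB Require Import structures.
From mathcomp Require Import all_boot all_order all_algebra.
From mathcomp Require Import complex.
From mathcomp Require Import boolp classical_sets reals topology normedtype.
From mathcomp Require Import derive.

Set Implicit Arguments.
Unset Strict Implicit.
Unset Printing Implicit Defensive.

Import Order.TTheory GRing.Theory Num.Theory.
Import numFieldNormedType.Exports.

Local Open Scope classical_set_scope.
Local Open Scope ring_scope.
Local Open Scope complex_scope.

(* Complex Frechet differentiability at every point of [U]. It is only used for
   open sets [U], where it depends on the restriction of [f] to [U] alone. *)
Definition holomorphic_on (R : realType) (V W : normedModType R[i])
    (U : set V) (f : V -> W) : Prop :=
  forall v : V, U v -> differentiable f v.

(* A chart is a bijection from [chart_dom] onto an open subset of a complete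
   complex normable space. The model space comes with one of its norms, but only
   its topology matters: openness and differentiability are the same for all the
   norms that define it. Model spaces may vary from chart to chart. The values of
   [chart_map] outside [chart_dom] are irrelevant. *)
Record holo_chart (R : realType) (X : Type) := HoloChart {
  chart_space : completeNormedModType R[i] ;
  chart_dom : set X ;
  chart_map : X -> chart_space ;
  chart_inj : forall x y : X, chart_dom x -> chart_dom y ->
    chart_map x = chart_map y -> x = y ;
  chart_open : open (chart_map @` chart_dom) }.

(* [g] is (a total extension of) the transition map [d \o c^-1]. *)
Definition holo_compatible (R : realType) (X : Type) (c d : holo_chart R X) :
    Prop :=
  let U := chart_dom c `&` chart_dom d in
  open (@chart_map R X c @` U) /\
  exists g : chart_space c -> chart_space d,
    (forall x : X, U x -> g (chart_map c x) = chart_map d x) /\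
    holomorphic_on (@chart_map R X c @` U) g.

Record holo_manifold (R : realType) := HoloManifold {
  carrier :> Type ;
  atlas : holo_chart R carrier -> Prop ;
  atlas_cover : forall x : carrier, exists2 c, atlas c & chart_dom c x ;
  atlas_compatible : forall c d, atlas c -> atlas d -> holo_compatible c d }.

Section ManifoldTopology.
Variables (R : realType) (M : holo_manifold R).

(* The topology for which the charts are homeomorphisms between open sets. *)
Definition manifold_open : set (set M) :=
  [set U | forall c, atlas c -> open (@chart_map R M c @` (chart_dom c `&` U))].

Lemma manifold_openT : manifold_open setT.
Proof. by move=> c _; rewrite setIT; exact: chart_open. Qed.

Lemma manifold_openI : setI_closed manifold_open.
Proof.
move=> A B oA oB c ac; have := openI (oA c ac) (oB c ac).
congr open; rewrite eqEsubset; split=> [v [[x [cx Ax] <-]] [y [cy By] yx]|v].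
  have xy : y = x by exact: (chart_inj cy cx yx).
  by exists x => //; split=> //; split=> //; rewrite -xy.
by case=> x [cx [Ax Bx]] <-; split; exists x.
Qed.

Lemma manifold_open_bigcup (I : Type) (f : I -> set M) :
  (forall i, manifold_open (f i)) -> manifold_open (\bigcup_i f i).
Proof.
move=> of_ c ac; rewrite setI_bigcupr image_bigcup.
by apply: bigcup_open => i _; exact: of_.
Qed.

HB.instance Definition _ := gen_eqMixin (carrier M).
HB.instance Definition _ := gen_choiceMixin (carrier M).
HB.instance Definition _ := isOpenTopological.Build (carrier M)
  manifold_openT manifold_openI manifold_open_bigcup.

End ManifoldTopology.

(* In each chart [c], [g] is (a total extension of) [eta \o c^-1]. *)
Definition holomorphic_map (R : realType) (M : holo_manifold R)
    (E : normedModType R[i]) (eta : M -> E) : Prop :=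
  forall c : holo_chart R M, atlas c ->
    exists g : chart_space c -> E,
      (forall x : M, chart_dom c x -> g (chart_map c x) = eta x) /\
      holomorphic_on (@chart_map R M c @` chart_dom c) g.

Definition has_local_max_norm (R : realType) (M : holo_manifold R)
    (E : normedModType R[i]) (eta : M -> E) : Prop :=
  exists x : M, \forall y \near x, `|eta y| <= `|eta x|.

Definition strong_maximum_modulus (R : realType)
    (E : completeNormedModType R[i]) : Prop :=
  forall (M : holo_manifold R) (eta : M -> E),
    connected [set: M] -> holomorphic_map eta -> has_local_max_norm eta ->
    forall x y : M, eta x = eta y.

Definition closed_unit_disc (R : realType) : set R[i]^o :=
  [set z : R[i]^o | `|z| <= 1].

(* Only the values of [gamma] on the closed disc matter; [g] is its extension. *)
Definition holomorphic_on_disc (R : realType) (E : normedModType R[i])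
    (gamma : R[i]^o -> E) : Prop :=
  exists (U : set R[i]^o) (g : R[i]^o -> E),
    [/\ open U, @closed_unit_disc R `<=` U, holomorphic_on U g &
        forall z, closed_unit_disc z -> g z = gamma z].

Definition strictly_plurisubharmonic (R : realType)
    (E : completeNormedModType R[i]) : Prop :=
  forall gamma : R[i]^o -> E, holomorphic_on_disc gamma ->
    (forall z, closed_unit_disc z -> `|gamma z| = 1) ->
    forall z w, closed_unit_disc z -> closed_unit_disc w -> gamma z = gamma w.

(* Main.v *)
(* (<=) At a local maximum [a] of the norm, restrict [eta] (read in a chart) to a
   complex line through [a]. The mean value inequality for the circle makes the
   norm constant on a small disc of that line, so strict plurisubharmonicity,
   applied after rescaling, makes [eta] itself constant there: [eta] is constant
   near [a]. The set of points near which [eta] equals [eta a] is open, and it is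
   closed by the identity theorem: if [f] vanishes near [0] and is bounded by [C]
   on [|w - 1| <= 3], then applying the maximum principle to [w ^- n f w] gives
   [|f 1| <= C / 2 ^ n] for all [n].
   (=>) A disc in the unit sphere has constant norm, so the strong maximum modulus
   principle applies to its restriction to the open disc.

   Differentiability is not assumed continuous, so the mean value inequality rests
   on Goursat's lemma. Integrals are replaced by trapezoidal sums on dyadic
   subdivisions, which are exact on affine maps and additive under bisection; the
   lemma is applied to [f (exp w)] on the rectangle [-L, 0] x [0, 2 pi], whose
   horizontal sides cancel by periodicity. *)

Require Import Defs.
From HB Require Import structures.
From mathcomp Require Import all_boot all_order all_algebra.
From mathcomp Require Import complex.
From mathcomp Require Import boolp classical_sets reals topology normedtype.
From mathcomp Require Import landau derive sequences exp trigo.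
From mathcomp Require Import ring lra.

Set Implicit Arguments.
Unset Strict Implicit.
Unset Printing Implicit Defensive.

Import Order.TTheory GRing.Theory Num.Theory.
Import numFieldNormedType.Exports.

Local Open Scope classical_set_scope.
Local Open Scope ring_scope.
Local Open Scope complex_scope.

Local Notation Re := complex.Re.
Local Notation Im := complex.Im.
Import ComplexField.Normc.

(** * Real-valued norms *)

Section RealNorm.
Variables (R : realType) (V : normedModType R[i]).
Implicit Types (u v : V) (z : R[i]).

(** Norms here take values in [R[i]]. Since a norm is nonnegative, hence real, its real part loses
    nothing and allows order arguments in [R]. *)
Definition rnorm v : R := Re `|v|.

Lemma rnormE v : `|v| = (rnorm v)%:C.
Proof. by rewrite /rnorm RRe_real ?ger0_real. Qed.

Lemma rnorm_ge0 v : 0 <= rnorm v.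
Proof. by rewrite -ler0c -rnormE. Qed.

Lemma ler_rnormD u v : rnorm (u + v) <= rnorm u + rnorm v.
Proof. by rewrite -lecR rmorphD /= -!rnormE ler_normD. Qed.

Lemma rnormN v : rnorm (- v) = rnorm v.
Proof. by rewrite /rnorm normrN. Qed.

Lemma rnorm0 : rnorm (0 : V) = 0.
Proof. by rewrite /rnorm normr0. Qed.

Lemma rnorm0_eq0 v : rnorm v = 0 -> v = 0.
Proof. by move=> v0; apply: normr0_eq0; rewrite rnormE v0. Qed.

Lemma rnormZ z v : rnorm (z *: v) = normc z * rnorm v.
Proof.
by apply: complexI; rewrite -rnormE normrZ rmorphM /= -rnormE.
Qed.

Lemma rdistC u v : rnorm (u - v) = rnorm (v - u).
Proof. by rewrite /rnorm distrC. Qed.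

Lemma ler_rdistD w u v : rnorm (u - v) <= rnorm (u - w) + rnorm (w - v).
Proof. by apply: le_trans (ler_rnormD _ _); rewrite addrA subrK. Qed.

Lemma lerB_rnorm u v : rnorm u - rnorm v <= rnorm (u - v).
Proof. by rewrite lerBlDr; apply: le_trans (ler_rnormD _ _); rewrite subrK. Qed.

Lemma nbhs_rnormP v (A : set V) :
  nbhs v A <-> exists2 e : R, 0 < e & forall u, rnorm (u - v) < e -> A u.
Proof.
split=> [/nbhs_normP[e /= e0 eA]|[e e0 eA]].
  have eE : e = (Re e)%:C by rewrite RRe_real ?gtr0_real.
  exists (Re e); first by rewrite -ltcR -eE.
  by move=> u ue; apply: eA; rewrite /= distrC rnormE eE ltcR.
apply/nbhs_normP; exists e%:C; first by rewrite /= ltcR.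
by move=> u /=; rewrite distrC rnormE ltcR; exact: eA.
Qed.

End RealNorm.

Section ComplexModulus.
Variable R : realType.
Implicit Types z : R[i].

Lemma rnorm_normc z : rnorm (z : R[i]^o) = normc z.
Proof. by []. Qed.

Lemma normc_real (x : R) : normc x%:C = `|x|.
Proof.
rewrite /ComplexField.Normc.normc /=.
by rewrite expr0n /= mulr0n addr0 sqrtr_sqr. Qed.

Lemma normc_imag (x : R) : normc (0 +i* x) = `|x|.
Proof. by rewrite /= expr0n /= mulr0n add0r sqrtr_sqr. Qed.

Lemma normc_leD z : normc z <= `|Re z| + `|Im z|.
Proof.
case: z => x y; have -> : x +i* y = x%:C + (0 +i* y).
  by apply/eqP; rewrite eq_complex /= addr0 add0r !eqxx.
rewrite (le_trans (le_normcD _ _))// normc_real normc_imag.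
by rewrite /= addr0 add0r.
Qed.

Lemma closed_unit_discE (w : R[i]^o) : closed_unit_disc w <-> normc w <= 1.
Proof. by rewrite /closed_unit_disc /= (rnormE w) -[1]/(1%:C) lecR. Qed.

End ComplexModulus.

(** * First-order approximation of differentiable maps of one complex variable *)

Section ComplexDerivative.
Variables (R : realType) (E : normedModType R[i]).
Implicit Types (f : R[i]^o -> E) (w : R[i]^o).

(** The differential is [R[i]]-linear on a line, hence multiplication by the vector [v], its value
    at [1]. So [f] is compared with an affine map, on which trapezoidal sums are exact. *)
Lemma differentiable_approx f w : differentiable f w ->
  exists v, forall e : R, 0 < e -> exists2 d : R, 0 < d &
    forall w' : R[i]^o, normc (w' - w) < d ->
      rnorm (f w' - f w - (w' - w) *: v) <= e * normc (w' - w).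
Proof.
move=> df; exists ('d f w (1 : R[i]^o)) => e e0.
have /eqaddoP/(_ e%:C) := diff_locally df.
rewrite ltcR => /(_ e0) /nbhs_rnormP[d d0 H].
exists d => // w' w'd; have := H (w' - w).
rewrite subr0 rnorm_normc => /(_ w'd).
rewrite [X in `|X| <= _](_ : _ =
    f w' - f w - (w' - w) *: 'd f w (1 : R[i]^o)); last first.
  rewrite -linearZ /= [(w' - w)%R *: _]mulr1 /=.
  by rewrite -[RHS]addrA -opprD -[in RHS](subrK w w') addrK.
by rewrite rnormE (rnormE (w' - w : R[i]^o)) -rmorphM lecR.
Qed.

End ComplexDerivative.

(** * Trapezoidal sums *)

Section NestedIntervals.
Variable R : realType.

(** The common point is the supremum of the left endpoints, since each right endpoint is an upper
    bound of them. *)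
Lemma nested_intervals (x l : nat -> R) :
  (forall k, 0 <= l k) -> (forall k, x k <= x k.+1) ->
  (forall k, x k.+1 + l k.+1 <= x k + l k) ->
  exists c, forall k, x k <= c <= x k + l k.
Proof.
move=> l0 xS xlS.
have xle k j : (k <= j)%N -> x k <= x j.
  by move=> /subnK <-; elim: (j - k)%N => // i /le_trans; apply; exact: xS.
have xlle k j : (k <= j)%N -> x j + l j <= x k + l k.
  by move=> /subnK <-; elim: (j - k)%N => // i; apply: le_trans; exact: xlS.
have xl k j : x k <= x j + l j.
  have [/xle xkj|/ltnW/xlle] := leqP k j.
    by rewrite (le_trans xkj)// lerDl.
  by apply: le_trans; rewrite lerDl.
have hx : has_sup (range x).
  split; first by exists (x 0%N), 0%N.
  by exists (x 0%N + l 0%N) => _ [k _ <-].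
exists (sup (range x)) => k; apply/andP; split.
  by apply: ub_le_sup; [case: hx | exists k].
by apply: ge_sup; [case: hx | move=> _ [j _ <-]].
Qed.

End NestedIntervals.

Section Trapezoid.
Variables (R : realType) (E : normedModType R[i]).
Implicit Types (F G : R[i] -> E) (p d e : R[i]).

(** Trapezoidal rule for the integral of [F] along the segment from [p] to [p + d], cut into [2 ^ n]
    equal pieces. *)
Fixpoint trap n F p d : E :=
  if n is m.+1 then trap m F p (d / 2) + trap m F (p + d / 2) (d / 2)
  else (d / 2) *: (F p + F (p + d)).

Lemma trapB n F G p d :
  trap n (fun w => F w - G w) p d = trap n F p d - trap n G p d.
Proof.
elim: n p d => [|n IHn] p d /=; last by rewrite !IHn opprD addrACA.
by rewrite -scalerBr opprD addrACA.
Qed.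

Lemma trap_shift n F p d t :
  trap n F (p + t) d = trap n (fun w => F (w + t)) p d.
Proof.
elim: n p d => [|n IHn] p d /=; first by rewrite [p + t + d]addrAC.
by rewrite [p + t + _]addrAC !IHn.
Qed.

Lemma eq_trap n F G p d : F =1 G -> trap n F p d = trap n G p d.
Proof. by move=> FG; elim: n p d => /= [|n IHn] p d; rewrite ?FG ?IHn. Qed.

(** The coefficient of [v] is [((p + d) ^ 2 - p ^ 2) / 2], so the value is the exact integral at
    every depth [n]. *)
Lemma trap_affine n (u v : E) p d :
  trap n (fun w => u + w *: v) p d = d *: u + (d * p + d ^+ 2 / 2) *: v.
Proof.
elim: n p d => [|n IHn] p d /=.
  have uu : u + u = 2 *: u by rewrite scaler_nat mulr2n.
  rewrite addrACA -scalerDl uu scalerDr !scalerA.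
  by congr (_ *: _ + _ *: _); field.
rewrite !IHn addrACA -(scalerDl u) -(scalerDl v).
by congr (_ *: _ + _ *: _); field.
Qed.

(** Every node of [trap] arises from the endpoints by repeated bisection, so this condition keeps
    all nodes in [K]. *)
Definition midpoint_closed (K : set R[i]) :=
  forall p d, K p -> K (p + d) -> K (p + d / 2).

Lemma normc_half d : normc (d / 2) = normc d / 2.
Proof.
rewrite normcM normcV; congr (_ / _).
by rewrite -(rmorph_nat (real_complex R)) normc_real ger0_norm.
Qed.

Lemma trap_bound n F (K : set R[i]) p d M : midpoint_closed K ->
  K p -> K (p + d) -> (forall w, K w -> rnorm (F w) <= M) ->
  rnorm (trap n F p d) <= normc d * M.
Proof.
move=> Kmid Kp Kpd FM; elim: n p d Kp Kpd => [|n IHn] p d Kp Kpd /=.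
  rewrite rnormZ normc_half -mulrA ler_wpM2l//; first exact: (@rnorm_ge0 _ R[i]^o).
  by rewrite ler_pdivrMl// mulr_natl mulr2n (le_trans (ler_rnormD _ _))// lerD ?FM.
have Km := Kmid _ _ Kp Kpd.
rewrite (le_trans (ler_rnormD _ _))// (splitr (normc d)) mulrDl -normc_half.
by rewrite lerD// IHn// -addrA -splitr.
Qed.

(** Discrete contour integral around the parallelogram with corner [p] and sides [d] and [e],
    traversed along [d] first. *)
Definition trap_bdry n F p d e : E :=
  trap n F p d + trap n F (p + d) e - trap n F (p + e) d - trap n F p e.

Lemma trap_bdryB n F G p d e : trap_bdry n (fun w => F w - G w) p d e =
  trap_bdry n F p d e - trap_bdry n G p d e.
Proof.
rewrite /trap_bdry !trapB !opprD !opprK.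
by rewrite (AC (2*2*2*2) ((1*3*5*7)*(2*4*6*8)))/=.
Qed.

Lemma trap_bdry_affine n (u v : E) p d e :
  trap_bdry n (fun w => u + w *: v) p d e = 0.
Proof.
rewrite /trap_bdry !trap_affine.
rewrite !opprD -!(scaleNr _ u) -!(scaleNr _ v) 
  (AC (2*2*2*2) ((1*3*5*7)*(2*4*6*8)))/=.
  rewrite -!(scalerDl u) -!(scalerDl v).
by rewrite [X in X *: u](_ : _ = 0) ?[X in X *: v](_ : _ = 0) ?scale0r ?addr0//;
  field.
Qed.

(** Each inner side of the four quarters is traversed once in each direction and cancels. The half
    sides on the outside join into the sides of the large parallelogram, one level deeper. *)
Lemma trap_bdryS n F p d e : trap_bdry n.+1 F p d e =
  trap_bdry n F p (d / 2) (e / 2) + trap_bdry n F (p + d / 2) (d / 2) (e / 2) +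
  trap_bdry n F (p + e / 2) (d / 2) (e / 2) +
  trap_bdry n F (p + d / 2 + e / 2) (d / 2) (e / 2).
Proof.
rewrite /trap_bdry /=.
have -> : p + d = p + d / 2 + d / 2 by field.
have -> : p + e = p + e / 2 + e / 2 by field.
have -> : p + d / 2 + d / 2 + e / 2 = p + d / 2 + e / 2 + d / 2 by ring.
have -> : p + e / 2 + e / 2 + d / 2 = p + d / 2 + e / 2 + e / 2 by ring.
have -> : p + e / 2 + d / 2 = p + d / 2 + e / 2 by ring.
(* The first four pairs are the outer sides, the last four are the cancelling inner ones. *)
rewrite [RHS](AC (4*4*4*4) (((1*5)*(6*14)*(11*15)*(4*12))*
  ((2*8)*(9*3)*(10*16)*(13*7))))/=.
by rewrite !subrr !addr0 !opprD.
Qed.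

End Trapezoid.

(** * Goursat's lemma *)

Section Rectangles.
Variable R : realType.
Implicit Types (p w z d : R[i]) (a b : R).

Lemma ReD w z : Re (w + z) = Re w + Re z.
Proof. by case: w z => [? ?] []. Qed.

Lemma ImD w z : Im (w + z) = Im w + Im z.
Proof. by case: w z => [? ?] []. Qed.

Lemma half_complex d : d / 2 = (Re d / 2) +i* (Im d / 2).
Proof.
apply: (@mulIf _ 2); first by rewrite pnatr_eq0.
rewrite divfK ?pnatr_eq0// mulr_natr mulr2n [LHS]complexE.
by apply/eqP; rewrite -complexE eq_complex /= -!splitr !eqxx.
Qed.

Definition rect p a b : set R[i] :=
  [set w | Re p <= Re w <= Re p + a /\ Im p <= Im w <= Im p + b].

Lemma rect_midpoint_closed p a b : midpoint_closed (rect p a b).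
Proof.
move=> q d [/andP[r1 r2] /andP[i1 i2]] [/andP[s1 s2] /andP[j1 j2]].
move: s1 s2 j1 j2; rewrite /rect /= half_complex !ReD !ImD /= => *.
by split; lra.
Qed.

Lemma exists_geometric_lt (c e : R) : 0 <= c -> 0 < e ->
  exists k, c / 2 ^+ k < e.
Proof.
move=> c0 e0; exists (Num.bound (c / e)).
rewrite ltr_pdivrMr ?exprn_gt0// mulrC -ltr_pdivrMr//.
apply: lt_trans (archi_boundP _) _; first by rewrite divr_ge0// ltW.
by rewrite -natrX ltr_nat ltn_expl.
Qed.

End Rectangles.

Section Goursat.
Variables (R : realType) (E : normedModType R[i]).
Implicit Types (F G : R[i] -> E) (p w z d : R[i]) (a b : R).

(** The factor [2 * (a + b)] is the perimeter: each side contributes its length times [M]. *)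
Lemma trap_bdry_bound n G p a b M : 0 <= a -> 0 <= b ->
  (forall w, rect p a b w -> rnorm (G w) <= M) ->
  rnorm (trap_bdry n G p a%:C (0 +i* b)) <= 2 * (a + b) * M.
Proof.
move=> a0 b0 GM; have mid := @rect_midpoint_closed R p a b.
have rp x y : 0 <= x <= a -> 0 <= y <= b -> rect p a b (p + (x +i* y)).
  by move=> /andP[? ?] /andP[? ?]; rewrite /rect /= ReD ImD /=; split; lra.
have p0 : rect p a b p by rewrite /rect /=; split; lra.
have pa : rect p a b (p + a%:C) by apply: rp; lra.
have pb : rect p a b (p + 0 +i* b) by apply: rp; lra.
have pab : rect p a b (p + a%:C + 0 +i* b).
  by rewrite -addrA; apply: rp => /=; lra.
have pba : rect p a b (p + 0 +i* b + a%:C) by rewrite addrAC.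
have := trap_bound n mid p0 pa GM; have := trap_bound n mid p0 pb GM.
have := trap_bound n mid pa pab GM; have := trap_bound n mid pb pba GM.
rewrite !normc_real !normc_imag !ger0_norm// => t1 t2 t3 t4.
rewrite /trap_bdry; move: t1 t2 t3 t4; do 4!move: (trap n G _ _).
move=> A D B C t1 t2 t3 t4.
have := ler_rnormD (A + B - C) (- D); have := ler_rnormD (A + B) (- C).
by have := ler_rnormD A B; rewrite !rnormN; lra.
Qed.

(** If the bound failed, repeated bisection would give nested rectangles on which it fails at scale
    [eps / 4 ^+ k]. They shrink to a point, and differentiability there contradicts the failure for
    large [k]. *)
Lemma goursat F p a b (eps : R) : 0 <= a -> 0 <= b -> 0 < eps ->
  (forall w, rect p a b w -> differentiable (F : R[i]^o -> E) (w : R[i]^o)) ->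
  exists N, forall n, (N <= n)%N ->
    rnorm (trap_bdry n F p a%:C (0 +i* b)) <= eps.
Proof.
move=> a0 b0 e0 dF.
have pow2 k : 0 < 2 ^+ k :> R by rewrite exprn_gt0.
pose ak k := a / 2 ^+ k; pose bk k := b / 2 ^+ k.
have ak0 k : 0 <= ak k by rewrite divr_ge0// ltW.
have bk0 k : 0 <= bk k by rewrite divr_ge0// ltW.
have half (c : R) k : c / 2 ^+ k.+1 = c / 2 ^+ k / 2.
  by rewrite exprSr invfM mulrA.
have akS k : (ak k)%:C / 2 = (ak k.+1)%:C.
  by rewrite half_complex /= mul0r /ak half.
have bkS k : (0 +i* bk k) / 2 = 0 +i* (bk k.+1).
  by rewrite half_complex /= mul0r /bk half.
pose good k q := exists N, forall n, (N <= n)%N ->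
  rnorm (trap_bdry n F q (ak k)%:C (0 +i* bk k)) <= eps / 4 ^+ k.
(* A bad rectangle has a bad quarter. The badness hypothesis stands under the existential so that
   choice yields a total function [nxt]. *)
have step (s : nat * R[i]) : exists q, ~ good s.1 s.2 ->
    [/\ ~ good s.1.+1 q, Re s.2 <= Re q <= Re s.2 + ak s.1.+1 &
        Im s.2 <= Im q <= Im s.2 + bk s.1.+1].
  case: s => k q /=; apply: contrapT => /forallNP noq.
  have bad1 q' : Re q <= Re q' <= Re q + ak k.+1 ->
      Im q <= Im q' <= Im q + bk k.+1 -> good k.+1 q'.
    by move=> r i; apply: contrapT => g; apply: (noq q').
  have ak1 := ak0 k.+1; have bk1 := bk0 k.+1.
  have [||N1 g1] := bad1 q; [lra|lra|].
  have [||N2 g2] := bad1 (q + (ak k.+1)%:C);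
    [rewrite !ReD/=; lra|rewrite !ImD/=; lra|].
  have [||N3 g3] := bad1 (q + (0 +i* bk k.+1));
    [rewrite !ReD/=; lra|rewrite !ImD/=; lra|].
  have [||N4 g4] := bad1 (q + (ak k.+1)%:C + (0 +i* bk k.+1));
    [rewrite !ReD/=; lra|rewrite !ImD/=; lra|].
  (* Depth [n.+1] on the rectangle is depth [n] on its quarters, hence the successor. *)
  apply: (noq q) => -[]; exists (maxn N1 (maxn N2 (maxn N3 N4))).+1 => -[//|n].
  rewrite ltnS !geq_max => /and4P[n1 n2 n3 n4].
  rewrite trap_bdryS akS bkS.
  move: (g1 _ n1) (g2 _ n2) (g3 _ n3) (g4 _ n4); do 4!move: (trap_bdry n F _ _ _).
  move=> D C B A tA tB tC tD.
  have := ler_rnormD (A + B + C) D; have := ler_rnormD (A + B) C.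
  have := ler_rnormD A B.
  have -> : eps / 4 ^+ k = 4 * (eps / 4 ^+ k.+1).
    by rewrite exprSr invfM; field; rewrite expf_neq0 ?pnatr_eq0.
  lra.
have [nxt nxtP] := choice step.
apply: contrapT => bad0.
pose P := fix P k := if k is j.+1 then nxt (j, P j) else p.
have badP k : ~ good k (P k).
  elim: k => [|k IHk]; first by rewrite /good /ak /bk !expr0 !divr1.
  by have [] := nxtP (k, P k) IHk.
have PS k : Re (P k) <= Re (P k.+1) <= Re (P k) + ak k.+1 /\
            Im (P k) <= Im (P k.+1) <= Im (P k) + bk k.+1.
  by have [] := nxtP (k, P k) (badP k).
have akD k : ak k = ak k.+1 + ak k.+1 by rewrite {2 3}/ak half -splitr.
have bkD k : bk k = bk k.+1 + bk k.+1 by rewrite {2 3}/bk half -splitr.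
have [x xP] : exists x, forall k, Re (P k) <= x <= Re (P k) + ak k.
  by apply: nested_intervals => // k; have [? ?] := PS k; rewrite ?(akD k); lra.
have [y yP] : exists y, forall k, Im (P k) <= y <= Im (P k) + bk k.
  by apply: nested_intervals => // k; have [? ?] := PS k; rewrite ?(bkD k); lra.
have rz : rect p a b (x +i* y).
  move: (xP 0%N) (yP 0%N); rewrite /ak /bk !expr0 !divr1.
  by split.
have [v Fv] := differentiable_approx (dF _ rz).
(* Perimeter times error is at most [eps / c * 2 * (a + b) ^+ 2 / 4 ^+ k], which this [c] brings
   below [eps / 4 ^+ k]; the added [1] keeps [c] positive for a degenerate rectangle. *)
pose c := 2 * (a + b) ^+ 2 + 1.
have c0 : 0 < c by rewrite ltr_wpDl// mulr_ge0// sqr_ge0.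
have [d d0 Fd] := Fv _ (divr_gt0 e0 c0).
have [k kd] := exists_geometric_lt (addr_ge0 a0 b0) d0.
apply: (badP k); exists 0%N => n _.
(* Subtracting the affine approximation at the limit point leaves the boundary sum unchanged. *)
pose G w := F w - (F (x +i* y) - (x +i* y) *: v + w *: v).
have -> : trap_bdry n F (P k) (ak k)%:C (0 +i* bk k) =
    trap_bdry n G (P k) (ak k)%:C (0 +i* bk k).
  by rewrite /G trap_bdryB trap_bdry_affine subr0.
have Gb w : rect (P k) (ak k) (bk k) w ->
    rnorm (G w) <= eps / c * ((a + b) / 2 ^+ k).
  move=> [rw iw]; have wz : normc (w - (x +i* y)) <= (a + b) / 2 ^+ k.
    rewrite (le_trans (normc_leD _))// mulrDl -/(ak k) -/(bk k).
    move: (xP k) (yP k); rewrite ReD ImD /= => ? ?.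
    by rewrite lerD// ler_norml; lra.
  have -> : G w = F w - F (x +i* y) - (w - (x +i* y)) *: v.
    by rewrite /G scalerBl !opprD !opprK !addrA addrAC.
  rewrite (le_trans (Fd _ (le_lt_trans wz kd)))// ler_wpM2l//.
  by rewrite divr_ge0// ltW.
have := trap_bdry_bound n (ak0 k) (bk0 k) Gb.
move=> /le_trans; apply.
rewrite /ak /bk -mulrDl.
have -> : (4 : R) ^+ k = 2 ^+ k * 2 ^+ k by rewrite -exprMn -natrM.
have -> : 2 * ((a + b) / 2 ^+ k) * (eps / c * ((a + b) / 2 ^+ k)) =
    eps / (2 ^+ k * 2 ^+ k) * ((c - 1) / c).
  by rewrite /c; field; rewrite -/c gt_eqF//= expf_neq0 ?pnatr_eq0.
rewrite ler_piMr//; first by rewrite divr_ge0// ?mulr_ge0// ltW.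
by rewrite ler_pdivrMr// mul1r gerBl.
Qed.

End Goursat.

(** * The complex exponential *)

Section ComplexExponential.
Variable R : realType.
Implicit Types (w h : R[i]^o) (x y e : R).

Lemma ler_Re_normc (z : R[i]) : `|Re z| <= normc z.
Proof. by case: z => x y /=; rewrite -sqrtr_sqr ler_wsqrtr// lerDl sqr_ge0. Qed.

Lemma ler_Im_normc (z : R[i]) : `|Im z| <= normc z.
Proof. by case: z => x y /=; rewrite -sqrtr_sqr ler_wsqrtr// lerDr sqr_ge0. Qed.

Lemma normc_ge0 (z : R[i]) : 0 <= normc z.
Proof. exact: (@rnorm_ge0 _ R[i]^o). Qed.

Definition cexp w : R[i]^o :=
  (expR (Re w) * cos (Im w)) +i* (expR (Re w) * sin (Im w)).

Lemma cexpD w h : cexp (w + h) = cexp w * cexp h.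
Proof.
rewrite /cexp ReD ImD expRD cosD sinD.
by apply/eqP; rewrite eq_complex /=; apply/andP; split; apply/eqP; ring.
Qed.

Lemma cexp0 : cexp 0 = 1.
Proof. by rewrite /cexp /= expR0 cos0 sin0 mulr1 mulr0. Qed.

Lemma normc_cexp w : normc (cexp w) = expR (Re w).
Proof.
rewrite /= !exprMn -mulrDr cos2Dsin2 mulr1 sqrtr_sqr ger0_norm//.
exact: expR_ge0.
Qed.

Lemma cexpD2pi w : cexp (w + (0 +i* (pi *+ 2))) = cexp w.
Proof.
rewrite cexpD [X in _ * X](_ : _ = 1) ?mulr1//.
by rewrite /cexp /= expR0 cos2pi sin2pi mulr1 mulr0.
Qed.

Lemma is_derive0_approx (f : R -> R) (l e : R) : is_derive (0 : R) 1 f l -> 0 < e ->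
  exists2 d, 0 < d & forall x, `|x| < d -> `|f x - f 0 - l * x| <= e * `|x|.
Proof.
move=> [df fl] e0; have /derivable1_diffP/diff_locally/eqaddoP/(_ _ e0) := df.
move=> /nbhs_normP[d /= d0 fd]; exists d => // x xd.
have := fd x; rewrite /= sub0r normrN => /(_ xd).
rewrite [X in `|X| <= _](_ : _ = f x - f 0 - l * x)//.
have -> : l * x = x *: 'd f 0 (1 : R).
  by rewrite mulrC -fl deriveE//; exact/derivable1_diffP.
rewrite -linearZ /= [x *: _]mulr1.
by rewrite -[RHS]addrA -opprD -[X in _ = f X - _](addr0 x).
Qed.

(** The derivative at [0] is [1]: both coordinates of the error are expressed by the first-order
    errors of [expR], [cos] and [sin] at [0]. *)
Lemma cexp_approx e : 0 < e -> exists2 d, 0 < d &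
  forall h : R[i], normc h < d -> normc (cexp h - 1 - h) <= e * normc h.
Proof.
(* Each coordinate of the error will be at most [3 * t * m], where [m] is the modulus of [h]. *)
move=> e0; pose t := Num.min 1 (e / 6).
have t0 : 0 < t by rewrite lt_min ltr01 divr_gt0.
have t1 : t <= 1 by rewrite ge_min lexx.
have te : 6 * t <= e by rewrite mulrC -ler_pdivlMr// ge_min lexx orbT.
have [d1 d10 expd] := is_derive0_approx (is_derive_expR 0) t0.
have [d2 d20 cosd] := is_derive0_approx (is_derive_cos 0) t0.
have [d3 d30 sind] := is_derive0_approx (is_derive_sin 0) t0.
exists (Num.min (Num.min d1 d2) (Num.min d3 (t / 2))).
  by rewrite !lt_min d10 d20 d30 divr_gt0.
case=> x y; rewrite !lt_min => /andP[/andP[h1 h2] /andP[h3 h4]].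
have rx := ler_Re_normc (x +i* y); have iy := ler_Im_normc (x +i* y).
move: rx iy h1 h2 h3 h4; set m := normc _; rewrite [Re _]/= [Im _]/=.
move=> rx iy h1 h2 h3 h4.
have := expd x (le_lt_trans rx h1); rewrite expR0 mul1r => Ex.
have := cosd y (le_lt_trans iy h2); rewrite cos0 sin0 oppr0 mul0r subr0 => Cy.
have := sind y (le_lt_trans iy h3); rewrite cos0 sin0 subr0 mul1r => Sy.
have m0 : 0 <= m by exact: normc_ge0.
have Ex1 : `|expR x - 1| <= t.
  have -> : expR x - 1 = expR x - 1 - x + x by ring.
  have := ler_normD (expR x - 1 - x) x; have : t * `|x| <= `|x| by rewrite ler_piMl.
  lra.
have Ex2 : 0 <= expR x <= 2.
  by rewrite expR_ge0; move: Ex1; rewrite ler_norml; lra.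
rewrite (le_trans (normc_leD _))//.
rewrite (_ : Re _ = (expR x - 1 - x) + expR x * (cos y - 1)); last first.
  by rewrite /=; ring.
rewrite (_ : Im _ = expR x * (sin y - y) + (expR x - 1) * y); last first.
  by rewrite /=; ring.
have a1 := ler_normD (expR x - 1 - x) (expR x * (cos y - 1)).
have a2 := ler_normD (expR x * (sin y - y)) ((expR x - 1) * y).
rewrite !normrM (ger0_norm (expR_ge0 _)) in a1 a2.
have tm (z : R) : `|z| <= m -> t * `|z| <= t * m by rewrite ler_pM2l.
have b1 : expR x * `|cos y - 1| <= 2 * (t * m).
  by rewrite ler_pM// ?expR_ge0 ?(le_trans Cy (tm _ iy))//; lra.
have b2 : expR x * `|sin y - y| <= 2 * (t * m).
  by rewrite ler_pM// ?expR_ge0 ?(le_trans Sy (tm _ iy))//; lra.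
have b3 : `|expR x - 1| * `|y| <= t * m by rewrite ler_pM.
have b4 := tm _ rx.
have : 6 * t * m <= e * m by rewrite ler_wpM2r.
lra.
Qed.

(** The functional equation moves the expansion at [0] to [w], multiplying the error by the modulus
    [expR (Re w)] of [cexp w]. *)
Lemma differentiable_cexp w : differentiable cexp w.
Proof.
apply/derivable1_diffP/cvg_ex; exists (cexp w); apply/cvgrPdist_le => e e0.
have eE : e = (Re e)%:C by rewrite RRe_real ?gtr0_real.
have c0 : 0 < expR (Re w) by exact: expR_gt0.
have er0 : 0 < Re e / expR (Re w) by rewrite divr_gt0// -ltcR -eE.
have [d d0 H] := cexp_approx er0.
apply/nbhs_rnormP; exists d => // h; rewrite subr0 => hd h0.
rewrite rnormE eE lecR.
rewrite [X in rnorm X](_ : _ = - (h^-1 * cexp w * (cexp h - 1 - h))); last first.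
  rewrite -[LHS]/((cexp w - h^-1 * (cexp (h * 1 + w) - cexp w) : R[i])).
  by rewrite mulr1 cexpD; field.
rewrite rnormN rnorm_normc !normcM normcV normc_cexp.
have hn : 0 < normc h.
  rewrite lt_neqAle normc_ge0 andbT eq_sym.
  by apply: contra h0 => /eqP/eq0_normc/eqP.
rewrite mulrAC -ler_pdivlMr// ler_pdivrMl// (le_trans (H _ hd))//.
by rewrite mulrC.
Qed.

End ComplexExponential.

(** * Mean value inequality *)

Section MeanValue.
Variables (R : realType) (E : normedModType R[i]).
Implicit Types (F : R[i] -> E) (p w z : R[i]) (l M D : R).

Lemma trap_vertical_bound n F p l M : 0 <= l ->
  (forall w, rect p 0 l w -> rnorm (F w) <= M) ->
  rnorm (trap n F p (0 +i* l)) <= l * M.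
Proof.
move=> l0 FM; have := @trap_bound _ _ n F _ p (0 +i* l) M
  (@rect_midpoint_closed R p 0 l).
by rewrite normc_imag ger0_norm//; apply=> //; rewrite /rect /= ?ReD ?ImD /=; lra.
Qed.

(** The first of the [2 ^ m] dyadic pieces has the better bound [M - D] and saves [D] times its
    length. Depth [m + n] lets [m] bisections isolate that piece. *)
Lemma trap_arc_bound n m F p l M D : 0 <= l ->
  (forall w, rect p 0 l w -> rnorm (F w) <= M) ->
  (forall w, rect p 0 (l / 2 ^+ m) w -> rnorm (F w) <= M - D) ->
  rnorm (trap (m + n) F p (0 +i* l)) <= l * (M - D / 2 ^+ m).
Proof.
move=> l0 FM; elim: m l l0 FM => [|m IHm] l l0 FM FD.
  by move: FD; rewrite expr0 !divr1; exact: trap_vertical_bound.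
have h0 : 0 <= l / 2 by rewrite divr_ge0.
rewrite addSn /= half_complex /= mul0r.
have b1 : rnorm (trap (m + n) F p (0 +i* (l / 2))) <= l / 2 * (M - D / 2 ^+ m).
  apply: IHm => // w; first by move=> [? ?]; apply: FM; split=> //; lra.
  by rewrite -mulrA -invfM -exprS; exact: FD.
have b2 : rnorm (trap (m + n) F (p + (0 +i* (l / 2))) (0 +i* (l / 2))) <= l / 2 * M.
  apply: trap_vertical_bound => // w; rewrite /rect /= ReD ImD /= => -[? ?].
  by apply: FM; split; lra.
have := ler_rnormD (trap (m + n) F p (0 +i* (l / 2)))
  (trap (m + n) F (p + (0 +i* (l / 2))) (0 +i* (l / 2))).
have -> : l * (M - D / 2 ^+ m.+1) = l / 2 * (M - D / 2 ^+ m) + l / 2 * M.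
  by rewrite exprS invfM; field; rewrite expf_neq0 ?pnatr_eq0.
lra.
Qed.

Lemma differentiable_rnorm_continuous (V : normedModType R[i]) (f : V -> E) v
    (e : R) :
  differentiable f v -> 0 < e ->
  exists2 d : R, 0 < d & forall u, rnorm (u - v) < d -> rnorm (f u - f v) < e.
Proof.
move=> /differentiable_continuous/cvgrPdist_lt/(_ e%:C) fv e0.
have /nbhs_rnormP[d d0 fd] := fv ltac:(by rewrite ltcR).
by exists d => // u /fd; rewrite rnormE ltcR rdistC.
Qed.

(** Goursat's lemma for [f \o cexp] compares the sum over the unit circle with that over a circle so
    small that [f] is close to [f 0] on it. The arc with the better bound is the fraction [2 ^- m]
    of the circle. *)
Lemma rnorm_center_le (f : R[i]^o -> E) M D m :
  (forall w, normc w <= 1 -> differentiable f (w : R[i]^o)) ->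
  (forall w, normc w = 1 -> rnorm (f w) <= M) ->
  (forall y, 0 <= y <= pi *+ 2 / 2 ^+ m -> rnorm (f (cexp (0 +i* y))) <= M - D) ->
  rnorm (f 0) <= M - D / 2 ^+ m.
Proof.
move=> df fM fD; apply/ler_addgt0Pr => e e0.
have pi0 : 0 < pi :> R := pi_gt0 R.
have [] := @differentiable_rnorm_continuous _ f 0 (e / 2) (df 0 _).
- by rewrite normc0 ler01.
- by rewrite divr_gt0.
(* The small circle has radius [expR (- L)], less than [d] because [expR L >= 1 + L > d^-1]. *)
move=> d d0 fd; pose L := d^-1; have L0 : 0 < L by rewrite invr_gt0.
have Ld : expR (- L) < d.
  rewrite expRN -[ltRHS]invrK ltf_pV2 ?posrE ?invr_gt0 ?expR_gt0//.
  by rewrite (lt_le_trans _ (expR_ge1Dx _))// ltrDr ltr01.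
pose F (w : R[i]) : E := f (cexp w).
pose p : R[i] := - L +i* 0; pose T : R[i] := 0 +i* (pi *+ 2).
have dF w : rect p L (pi *+ 2) w -> differentiable (F : R[i]^o -> E) (w : R[i]^o).
  move=> [/andP[_ wL] _]; apply: differentiable_comp.
    exact: differentiable_cexp.
  by apply: df; rewrite normc_cexp -expR0 ler_expR; move: wL; rewrite /=; lra.
have pi20 : 0 <= pi *+ 2 :> R by rewrite mulrn_wge0// ltW.
have [N Fbdry] := goursat (ltW L0) pi20 (mulr_gt0 pi0 e0) dF.
have := Fbdry (m + N)%N (leq_addl _ _); set n := (m + N)%N.
have -> : trap_bdry n F p L%:C T = trap n F 0 T - trap n F p T.
  rewrite /trap_bdry (trap_shift n F p L%:C T).
  rewrite (eq_trap _ _ _ (_ : _ =1 F)); last first.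
    by move=> w; rewrite /F cexpD2pi.
  rewrite [X in X - _ - _]addrC addrK.
  rewrite (_ : p + L%:C = 0)//.
  by apply/eqP; rewrite eq_complex /= addNr addr0 !eqxx.
have TE : normc T = pi * 2 by rewrite normc_imag ger0_norm// mulr_natr.
have right : rnorm (trap n F 0 T) <= pi *+ 2 * (M - D / 2 ^+ m).
  apply: trap_arc_bound => // w [rw iw].
    apply: fM; rewrite normc_cexp.
    by rewrite (_ : Re w = 0) ?expR0//; move: rw; rewrite /=; lra.
  have -> : w = 0 +i* Im w.
    by apply/eqP; rewrite eq_complex /= eqxx andbT; move: rw; rewrite /=; lra.
  by apply: fD; move: iw; rewrite /= add0r.
have left : rnorm (trap n F p T - T *: f 0) <= pi *+ 2 * (e / 2).
  have -> : trap n F p T - T *: f 0 =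
      trap n (fun w => F w - (f 0 + w *: 0)) p T.
    by rewrite trapB trap_affine scaler0 addr0.
  apply: trap_vertical_bound => // w [rw iw]; rewrite scaler0 addr0 ltW// fd//.
  rewrite subr0 rnorm_normc normc_cexp (_ : Re w = - L)//.
  by move: rw; rewrite /=; lra.
(* Goursat's lemma and the small circle each contribute an error [pi * e]; division by [2 * pi]
   leaves [e]. *)
have := ler_rdistD (trap n F p T) (trap n F 0 T) (T *: f 0).
have := lerB_rnorm (T *: f 0) (trap n F 0 T).
rewrite rdistC rnormZ TE => s1 s2 s3.
rewrite -[pi *+ 2]mulr_natr in right left.
have : pi * 2 * rnorm (f 0) <= pi * 2 * (M - D / 2 ^+ m + e) by lra.
by rewrite ler_pM2l// mulr_gt0.
Qed.

End MeanValue.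

(** * Maximum and identity principles on a disc *)

Section DifferentiableScale.
Variables (K : numFieldType) (V : normedModType K).

Lemma derivable_scale (k : K -> K) (f : K -> V) (x : K) :
  derivable k x 1 -> derivable f x 1 -> derivable (fun w => k w *: f w) x 1.
Proof.
move=> dk df; apply/cvg_ex; exists (k x *: 'D_1 f x + 'D_1 k x *: f x).
rewrite [X in X @ _](_ : _ = fun h : K =>
    k (h *: 1 + x) *: (h^-1 *: (f (h *: 1 + x) - f x)) +
    (h^-1 *: (k (h *: 1 + x) - k x)) *: f x); last first.
  apply/funext => h /=; set a := k (h *: 1 + x); set b := f (h *: 1 + x).
  rewrite scalerA [a * _]mulrC -scalerA -[_ *: (a - k x)]/(h^-1 * (a - k x)).
  rewrite -scalerA -scalerDr; congr (_ *: _).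
  by rewrite scalerBr scalerBl addrA subrK.
apply: cvgD; last by apply: cvgZr_tmp; exact: dk.
apply: cvgZ; last exact: df.
suff : {for 0, continuous (fun h : K => k (h *: 1 + x))}.
  by move=> /continuous_withinNx; rewrite scale0r add0r.
exact/differentiable_continuous/derivable1_diffP/(derivable1P _ _ _).1.
Qed.

End DifferentiableScale.

Section Disc.
Variables (R : realType) (E : normedModType R[i]).
Implicit Types (w z : R[i]^o) (f : R[i]^o -> E).

Lemma differentiable_line (V : normedModType R[i]) (a h : V) w :
  differentiable (fun z : R[i]^o => a + z *: h) w.
Proof.
apply: differentiableD; first exact: differentiable_cst.
by apply: differentiableZl; exact: ex_diff.
Qed.

(** If the norm were smaller at [z], then [w |-> f (w *: z)] would have a smaller norm on an arc of
    the unit circle starting at [1], and the mean value inequality would be strict at the centre. *)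
Lemma rnorm_disc_const f :
  (forall w, normc w <= 1 -> differentiable f w) ->
  (forall w, normc w <= 1 -> rnorm (f w) <= rnorm (f 0)) ->
  forall z, normc z <= 1 -> rnorm (f z) = rnorm (f 0).
Proof.
move=> df fM z z1; apply/eqP; rewrite eq_le fM//= leNgt; apply/negP => fz.
pose g w := f (w *: z).
have zw w : normc w <= 1 -> normc (w *: z) <= 1.
  by move=> w1; rewrite normcM mulr_ile1// normc_ge0.
have dg w : normc w <= 1 -> differentiable g w.
  move=> w1; apply: differentiable_comp; last exact/df/zw.
  by apply: differentiableZl; exact: ex_diff.
(* Half of the gap is spent on continuity near [1], the other half is the saving on the arc. *)
pose D := (rnorm (f 0) - rnorm (f z)) / 2.
have D0 : 0 < D by rewrite divr_gt0// subr_gt0.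
have n1 : normc (1 : R[i]) <= 1 by rewrite normc1.
have [d d0 gd] := differentiable_rnorm_continuous (dg 1 n1) D0.
have [d' d'0 expd] :=
  differentiable_rnorm_continuous (differentiable_cexp (0 : R[i]^o)) d0.
have [m md] := exists_geometric_lt (mulrn_wge0 2 (pi_ge0 R)) d'0.
have := @rnorm_center_le _ _ g (rnorm (f 0)) D m dg _ _.
rewrite /g scale0r.
suff H : rnorm (f 0) <= rnorm (f 0) - D / 2 ^+ m -> False.
  move=> /(_ _ _)/H; apply.
    by move=> w w1; apply/fM/zw; rewrite w1.
  move=> y /andP[y0 ym].
  have := gd (cexp (0 +i* y)); rewrite /g scale1r.
  have := expd (0 +i* y); rewrite subr0 cexp0 !rnorm_normc normc_imag ger0_norm//.
  move=> /(_ (le_lt_trans ym md)) h /(_ h).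
  have := lerB_rnorm (f (cexp (0 +i* y) *: z)) (f z).
  rewrite /D; lra.
by rewrite lerDl oppr_ge0 leNgt divr_gt0// exprn_gt0.
Qed.

Lemma rnorm_center_le_circle f M :
  (forall w, normc w <= 1 -> differentiable f w) ->
  (forall w, normc w = 1 -> rnorm (f w) <= M) -> rnorm (f 0) <= M.
Proof.
move=> df fM; rewrite -[leRHS]subr0 -[X in _ - X](mul0r (2 ^+ 0)^-1).
apply: rnorm_center_le => // y _; rewrite subr0 fM// normc_cexp.
exact: expR0.
Qed.

(* Dividing [f] by [w ^+ n] is harmless because [f] vanishes near [0], while it
   gains a factor [2 ^- n] on the circle of centre [1] and radius [3]. *)
Lemma vanishing_near0_at1 f M :
  (forall w, normc (w - 1) <= 3 -> differentiable f w) ->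
  (forall w, normc (w - 1) <= 3 -> rnorm (f w) <= M) ->
  (\forall w \near (0 : R[i]^o), f w = 0) -> f 1 = 0.
Proof.
move=> df fM f0.
have normc3 : normc (3 : R[i]) = 3.
  by rewrite -(rmorph_nat (real_complex R)) normc_real ger0_norm.
have normcX n w : normc (w ^+ n) = normc w ^+ n.
  by elim: n => [|n IHn]; rewrite ?normc1// !exprS normcM IHn.
pose h n w := (w ^+ n)^-1 *: f w.
(* At [0] the value of the inverse does not matter: [h n] vanishes nearby because [f] does. *)
have dh n w : normc (w - 1) <= 3 -> differentiable (h n) w.
  move=> w3; apply/derivable1_diffP; have [->|w0] := eqVneq w 0.
    apply: (@near_eq_derivable _ _ _ (fun=> 0)); last exact: derivable_cst.
    by near=> u; rewrite /h (near f0 u)// scaler0.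
  rewrite /h; apply: (@derivable_scale R[i] E (fun w => (w ^+ n)^-1) f);
    last exact/derivable1_diffP/df.
  apply: derivableV; first by rewrite expf_neq0.
  exact: exprn_derivable.
have fn n : rnorm (f 1) <= M / 2 ^+ n.
  pose g w := h n (1 + w *: 3).
  have -> : f 1 = g 0 by rewrite /g /h scale0r addr0 expr1n invr1 scale1r.
  apply: rnorm_center_le_circle => w w1.
    apply: differentiable_comp; first exact: differentiable_line.
    by apply: dh; rewrite addrC addKr normcM normc3 ler_piMl.
  have w3 : normc (1 + w *: 3 - 1) = 3.
    by rewrite addrC addKr normcM normc3 w1 mul1r.
  have w2 : 2 <= normc (1 + w *: 3).
    have := lerB_rnorm (w *: 3 : R[i]^o) (-1).
    rewrite rnormN opprK rnormZ !rnorm_normc normc3 normc1 w1 [w *: 3 + 1]addrC; lra.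
  rewrite /g /h rnormZ mulrC.
  rewrite ler_pM ?rnorm_ge0 ?normc_ge0 ?fM ?w3//.
  rewrite normcV normcX lef_pV2 ?posrE ?exprn_gt0//; last lra.
  by rewrite lerXn2r ?nnegrE ?normc_ge0.
apply: rnorm0_eq0; apply/eqP; rewrite eq_le rnorm_ge0 andbT leNgt; apply/negP => f1.
have M0 : 0 <= M by apply: le_trans (fM 1 _); rewrite ?rnorm_ge0// subrr normc0.
have [n] := exists_geometric_lt M0 f1.
by rewrite ltNge fn.
Unshelve. all: by end_near.
Qed.

End Disc.

(** * From plurisubharmonicity to the maximum modulus principle *)

Section ManifoldNbhs.
Variables (R : realType) (M : holo_manifold R).
Implicit Types (c d : holo_chart R M) (y z : M) (A : set M).

(** Charts are open maps, by definition of the manifold topology. *)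
Lemma manifold_nbhs_chart c y A : atlas c -> chart_dom c y -> nbhs y A ->
  exists2 e : R, 0 < e & forall v : chart_space c, rnorm (v - chart_map c y) < e ->
    exists z, [/\ chart_dom c z, A z & chart_map c z = v].
Proof.
move=> ac cy; rewrite nbhsE => -[U [oU Uy] UA].
have : nbhs (chart_map c y) (@chart_map R M c @` (chart_dom c `&` U)).
  by apply: open_nbhs_nbhs; split; [exact: oU | exists y].
move=> /nbhs_rnormP[e e0 H]; exists e => // v /H [z [cz Uz] zv].
by exists z; split=> //; exact: UA.
Qed.

(** Charts are continuous: read in another chart [d], the preimage of a ball is open because the
    transition map from [d] to [c] is differentiable, hence continuous. *)
Lemma chart_nbhs_manifold c y A (e : R) : atlas c -> chart_dom c y -> 0 < e ->
  (forall z, chart_dom c z -> rnorm (chart_map c z - chart_map c y) < e -> A z) ->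
  nbhs y A.
Proof.
move=> ac cy e0 eA.
pose U := [set z | chart_dom c z /\ rnorm (chart_map c z - chart_map c y) < e].
rewrite nbhsE; exists U; last by move=> z [cz]; exact: eA.
split; last by split=> //; rewrite subrr rnorm0.
move=> d ad; rewrite openE => _ [z [dz [cz ze]] <-].
have [odc [g [gE dg]]] := atlas_compatible ad ac.
have gz : rnorm (chart_map c z - chart_map c y) < e by [].
have dcz : (@chart_map R M d @` (chart_dom d `&` chart_dom c)) (chart_map d z).
  by exists z.
have /nbhs_rnormP[e1 e10 H1] := open_nbhs_nbhs (conj odc dcz).
have r0 : 0 < e - rnorm (chart_map c z - chart_map c y) by rewrite subr_gt0.
have [e2 e20 H2] := differentiable_rnorm_continuous (dg _ dcz) r0.
apply/nbhs_rnormP; exists (Num.min e1 e2); first by rewrite lt_min e10.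
move=> u; rewrite lt_min => /andP[/H1[z' [dz' cz'] <-] /H2].
rewrite !gE// => h; exists z' => //; split=> //; split=> //.
have := ler_rdistD (chart_map c z) (chart_map c z') (chart_map c y); lra.
Qed.

End ManifoldNbhs.

(** * The identity and maximum principles on balls of a normed space *)

Section BallArguments.
Variables (R : realType) (V E : normedModType R[i]).
Implicit Types (g : V -> E) (a b u v : V) (e C : R).

(** On the complex line with [b] at [0] and [u] at [1], the difference [g - k] vanishes near [0],
    hence at [1]. For [normc (w - 1) <= 3] the line stays within [4 * (e / 8) + e / 16 < e] of
    [a]. *)
Lemma identity_on_ball g a b (k : E) e C :
  (forall v, rnorm (v - a) < e -> differentiable g v) ->
  (forall v, rnorm (v - a) < e -> rnorm (g v) <= C) ->
  rnorm (b - a) < e / 16 -> (\forall v \near b, g v = k) ->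
  forall u, rnorm (u - a) < e / 16 -> g u = k.
Proof.
move=> dg gC be gb u ue.
pose l (w : R[i]^o) := b + w *: (u - b).
have dl w : differentiable l w by exact: differentiable_line.
pose f w := g (l w) - k.
have lw w : normc (w - 1) <= 3 -> rnorm (l w - a) < e.
  move=> w3; rewrite /l addrAC (le_lt_trans (ler_rnormD _ _))// rnormZ.
  have ub : rnorm (u - b) < e / 8.
    by have := ler_rdistD a u b; rewrite (rdistC a b); lra.
  have w4 : normc w <= 4.
    by have := le_normcD (w - 1) 1; rewrite subrK normc1; lra.
  have : normc w * rnorm (u - b) <= 4 * (e / 8).
    by rewrite ler_pM ?normc_ge0 ?rnorm_ge0// ltW.
  have := rnorm_ge0 (b - a); lra.
suff : f 1 = 0.
  by rewrite /f /l scale1r [b + _]addrC subrK => /eqP; rewrite subr_eq0 => /eqP.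
apply: (@vanishing_near0_at1 _ _ f (C + rnorm k)).
- move=> w w3; apply: differentiableB; last exact: differentiable_cst.
  by apply: differentiable_comp => //; exact/dg/lw.
- by move=> w w3; rewrite (le_trans (ler_rnormD _ _))// rnormN lerD2r; exact/gC/lw.
- have lb : l @ (0 : R[i]^o) --> b.
    have -> : b = l 0 by rewrite /l scale0r addr0.
    exact/differentiable_continuous/dl.
  have gl : \forall w \near (0 : R[i]^o), g (l w) = k by exact: lb gb.
  by apply: filterS gl => w gw; rewrite /f gw subrr.
Qed.

End BallArguments.

Lemma const_on_ball (R : realType) (V : normedModType R[i])
    (E : completeNormedModType R[i]) (g : V -> E) a (e : R) :
  strictly_plurisubharmonic E ->
  (forall v, rnorm (v - a) < e -> differentiable g v) ->
  (forall v, rnorm (v - a) < e -> rnorm (g v) <= rnorm (g a)) ->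
  forall v, rnorm (v - a) < e -> g v = g a.
Proof.
(* A zero maximum cannot be normalised to [1], but it forces [g] to vanish on the ball. *)
move=> pshE dg gM v ve; have [ga0|ga0] := eqVneq (rnorm (g a)) 0.
  rewrite (rnorm0_eq0 ga0); apply: rnorm0_eq0; apply/eqP.
  by rewrite eq_le rnorm_ge0 andbT -[leRHS]ga0 gM.
pose r := rnorm (v - a); have r0 : 0 <= r by exact: rnorm_ge0.
have r1 : 0 < r + 1 by rewrite ltr_wpDl.
pose l (w : R[i]^o) := a + w *: (v - a).
have lE w : rnorm (l w - a) = normc w * r by rewrite /l [a + _]addrC addrK rnormZ.
have dl w : differentiable l w by exact: differentiable_line.
have le1 w : normc w <= 1 -> rnorm (l w - a) < e.
  by move=> w1; rewrite lE (le_lt_trans _ ve)// ler_piMl.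
have l0 : l 0 = a by rewrite /l scale0r addr0.
have fconst w : normc w <= 1 -> rnorm (g (l w)) = rnorm (g a).
  move=> w1; rewrite -[in RHS]l0; apply: (@rnorm_disc_const _ _ (g \o l)) => // z z1.
    by apply: differentiable_comp => //; exact/dg/le1.
  by rewrite /= l0; exact/gM/le1.
(* On the disc in the line from [a] to [v] the norm of [g] is constant, so scaling by [k] puts the
   image in the unit sphere. *)
pose k : R[i] := (rnorm (g a))^-1%:C.
pose gamma (w : R[i]^o) := k *: g (l w).
have discE := @closed_unit_discE R.
have hg : holomorphic_on_disc gamma.
  exists [set w | rnorm (l w - a) < e], gamma; split=> //.
  - rewrite openE => w /= we; apply/nbhs_rnormP.
    (* Dividing by [r + 1] rather than [r] covers the case [v = a]. *)
    exists ((e - rnorm (l w - a)) / (r + 1)).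
      by rewrite divr_gt0// subr_gt0.
    move=> w' /=; rewrite rnorm_normc ltr_pdivlMr// !lE => w'w.
    have := le_normcD w (w' - w); rewrite addrC subrK => t.
    have : normc w' * r <= (normc w + normc (w' - w)) * r by rewrite ler_wpM2r.
    have := normc_ge0 (w' - w); rewrite mulrDl; lra.
  - by move=> w /discE; exact: le1.
  - move=> w /= we; apply: differentiableZ; apply: differentiable_comp => //.
    exact: dg.
have gamma1 w : closed_unit_disc w -> `|gamma w| = 1.
  move=> /discE w1; rewrite rnormE rnormZ fconst// normc_real.
  rewrite ger0_norm ?invr_ge0 ?rnorm_ge0//.
  by rewrite mulVf.
have d0 : closed_unit_disc (0 : R[i]^o) by apply/discE; rewrite normc0.
have d1 : closed_unit_disc (1 : R[i]^o) by apply/discE; rewrite normc1.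
have := pshE _ hg gamma1 _ _ d1 d0; rewrite /gamma l0.
rewrite /l scale1r [a + _]addrC subrK => /scalerI; apply.
by rewrite eq_complex /= eqxx andbT invr_eq0.
Qed.

Lemma plurisubharmonic_maximum_modulus (R : realType)
    (E : completeNormedModType R[i]) :
  strictly_plurisubharmonic E -> strong_maximum_modulus E.
Proof.
move=> pshE M eta connM holo [x0 maxx0].
pose A := [set y : M | \forall z \near y, eta z = eta x0].
suff AT : A = setT.
  have etaE y : eta y = eta x0.
    by have : A y; [rewrite AT | exact: nbhs_singleton].
  by move=> x y; rewrite !etaE.
apply: connM.
(* Nonempty: [eta] is constant near its local maximum. *)
- exists x0; rewrite /A /=; have [c ac cx] := atlas_cover x0.
  have [g [gE dg]] := holo c ac.
  have [e e0 H] := manifold_nbhs_chart ac cx maxx0.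
  have gmax v : rnorm (v - chart_map c x0) < e ->
      rnorm (g v) <= rnorm (g (chart_map c x0)).
    by move=> /H[z [cz + <-]]; rewrite !gE// !rnormE lecR.
  have gdiff v : rnorm (v - chart_map c x0) < e -> differentiable g v.
    by move=> /H[z [cz _ <-]]; apply: dg; exists z.
  apply: (chart_nbhs_manifold ac cx e0) => z cz ze.
  by rewrite -!gE//; exact: (const_on_ball pshE gdiff gmax ze).
(* Open: [A] is the interior of a level set. *)
- exists A; last by rewrite setTI.
  exact: (@open_interior _ [set z : M | eta z = eta x0]).
(* Closed: near a point [y] of the closure, [eta] is bounded in a chart by continuity, and a point
   [b] of [A] within [e / 16] of [y] starts the identity principle. *)
- exists A; last by rewrite setTI.
  move=> y cly; have [c ac cy] := atlas_cover y.
  have [g [gE dg]] := holo c ac.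
  have [e1 e10 H1] := manifold_nbhs_chart ac cy filterT.
  have dgy : differentiable g (chart_map c y) by apply: dg; exists y.
  have [e2 e20 H2] := differentiable_rnorm_continuous dgy ltr01.
  pose e := Num.min e1 e2; have e0 : 0 < e by rewrite lt_min e10.
  have gdiff v : rnorm (v - chart_map c y) < e -> differentiable g v.
    by rewrite lt_min => /andP[/H1[z [cz _ <-]] _]; apply: dg; exists z.
  have gC v : rnorm (v - chart_map c y) < e ->
      rnorm (g v) <= rnorm (g (chart_map c y)) + 1.
    rewrite lt_min => /andP[_ /H2 h].
    have := lerB_rnorm (g v) (g (chart_map c y)); lra.
  have e16 : 0 < e / 16 by rewrite divr_gt0.
  pose B := [set z | chart_dom c z /\
    rnorm (chart_map c z - chart_map c y) < e / 16].
  have nB : nbhs y B by apply: (chart_nbhs_manifold ac cy e16) => z.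
  have [b [Ab [cb be]]] := cly _ nB.
  have [e3 e30 H3] := manifold_nbhs_chart ac cb Ab.
  have gb : \forall v \near chart_map c b, g v = eta x0.
    by apply/nbhs_rnormP; exists e3 => // v /H3[z [cz <- <-]]; rewrite gE.
  apply: (chart_nbhs_manifold ac cy e16) => z cz ze.
  by rewrite -gE//; exact: (identity_on_ball gdiff gC be gb ze).
Qed.

(** * From the maximum modulus principle to plurisubharmonicity *)

Section DiscManifold.
Variable R : realType.
Implicit Types w : R[i]^o.

(** [Re] and [Im] are 1-Lipschitz, so they carry [F] to Cauchy filters on [R], whose limits are the
    coordinates of the limit. *)
Lemma complex_complete (F : set_system R[i]^o) :
  ProperFilter F -> cauchy F -> cvg F.
Proof.
move=> FF Fc.
have coord (h : R[i] -> R) : (forall w z : R[i], `|h w - h z| <= normc (w - z)) ->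
    cvg (h @ F).
  move=> hE; apply: R_complete; apply/cauchy_ballP => e e0.
  have e0C : 0 < e%:C by rewrite ltcR.
  have H := (cauchy_ballP F).2 Fc _ e0C.
  near_simpl; rewrite near_map2; apply: filterS (H _) => -[w z].
  by rewrite -!ball_normE /= rnormE ltcR; exact/le_lt_trans/hE.
have ReB (w z : R[i]) : Re w - Re z = Re (w - z) by case: w z => [? ?] [].
have ImB (w z : R[i]) : Im w - Im z = Im (w - z) by case: w z => [? ?] [].
have [|x Fx] := iffLR (cvg_ex _) (coord (@complex.Re R) _).
  by move=> w z; rewrite ReB; exact: ler_Re_normc.
have [|y Fy] := iffLR (cvg_ex _) (coord (@complex.Im R) _).
  by move=> w z; rewrite ImB; exact: ler_Im_normc.
apply/cvg_ex; exists (x +i* y); apply/cvgrPdist_lt => e e0.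
have eE : e = (Re e)%:C by rewrite RRe_real ?gtr0_real.
have e20 : 0 < Re e / 2 by rewrite divr_gt0// -ltcR -eE.
have Rx := iffLR (cvgrPdist_lt _ _) Fx _ e20.
have Iy := iffLR (cvgrPdist_lt _ _) Fy _ e20.
near=> w; rewrite rnormE eE ltcR (le_lt_trans (normc_leD _))//.
rewrite -ReB -ImB [ltRHS]splitr ltrD//.
  by near: w; exact: Rx.
by near: w; exact: Iy.
Unshelve. all: by end_near.
Qed.

Definition open_disc := {z : R[i]^o | normc z < 1}.

Definition disc_space : completeNormedModType R[i] :=
  HB.pack_for (completeNormedModType R[i]) (R[i]^o)
    (Uniform_isComplete.Build _ complex_complete).

Lemma open_unit_disc : open [set z : R[i]^o | normc z < 1].
Proof.
rewrite openE => w /= w1; apply/nbhs_rnormP; exists (1 - normc w).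
  by rewrite subr_gt0.
move=> z /=; rewrite rnorm_normc => zw.
by have := le_normcD (z - w) w; rewrite subrK; lra.
Qed.

Lemma open_disc_chart :
  open ((@sval _ _ : open_disc -> disc_space) @` [set: open_disc]).
Proof.
rewrite (_ : image _ _ = [set z : R[i]^o | normc z < 1]).
  exact: open_unit_disc.
apply/seteqP; split=> [_ [z _ <-]|z z1]; first exact: (svalP z).
by exists (exist _ z z1).
Qed.

Definition disc_chart : holo_chart R open_disc :=
  @HoloChart R open_disc disc_space setT (@sval _ _)
    (fun x y _ _ => @val_inj _ _ _ x y) open_disc_chart.

Lemma disc_compatible (c d : holo_chart R open_disc) :
  c = disc_chart -> d = disc_chart -> holo_compatible c d.
Proof.
move=> -> ->; split; first by rewrite setIT; exact: open_disc_chart.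
by exists id; split=> // v _; exact: ex_diff.
Qed.

Definition disc_manifold : holo_manifold R :=
  @HoloManifold R open_disc (fun c => c = disc_chart)
    (fun x => ex_intro2 _ _ disc_chart erefl I) disc_compatible.

(** Projection onto [[0, 1]]; it makes each radius of the disc a path defined on all of [R]. *)
Definition clamp (t : R) : R := Num.max 0 (Num.min 1 t).

Lemma clamp_ge0_le1 t : 0 <= clamp t <= 1.
Proof. by rewrite le_max lexx ge_max ler01 ge_min lexx. Qed.

Lemma clamp_id t : 0 <= t <= 1 -> clamp t = t.
Proof. by case/andP => t0 t1; rewrite /clamp (min_idPr t1) (max_idPr t0). Qed.

Lemma clamp_lipschitz s t : `|clamp s - clamp t| <= `|s - t|.
Proof.
have clampE u : clamp u = if u <= 0 then 0 else if u <= 1 then u else 1.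
  rewrite /clamp; case: (leP u 1) => u1; case: (leP u 0) => u0 //.
    by lra.
  by rewrite max_r.
wlog st : s t / s <= t.
  move=> H; have [/H//|/ltW/H] := leP s t.
  by rewrite distrC (distrC t).
rewrite distrC (distrC s) [leRHS]ger0_norm ?subr_ge0// ler_norml !clampE.
by do 4?case: ifPn; rewrite -?ltNge => *; lra.
Qed.

Lemma disc_radius_proof (z : open_disc) (t : R) :
  normc ((clamp t)%:C *: sval z) < 1.
Proof.
have /andP[c0 c1] := clamp_ge0_le1 t.
rewrite normcM normc_real ger0_norm// (le_lt_trans _ (svalP z))//.
by rewrite ler_piMl// normc_ge0.
Qed.

Definition disc_radius (z : open_disc) (t : R) : disc_manifold :=
  exist _ ((clamp t)%:C *: sval z) (disc_radius_proof z t).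

Lemma disc_radius_continuous z : continuous (disc_radius z).
Proof.
move=> t A At.
have [e e0 H] := @manifold_nbhs_chart _ disc_manifold disc_chart
  (disc_radius z t) A erefl I At.
apply/nbhs_normP; exists e => //= s ts.
have [|y [_ Ay yE]] := H (sval (disc_radius z s)).
  rewrite /= -scalerBl rnormZ -rmorphB normc_real (le_lt_trans _ ts)//.
  rewrite (distrC t) (le_trans _ (clamp_lipschitz s t))// ler_piMr//.
  by rewrite ltW//; exact: (svalP z).
by have yz : y = disc_radius z s; [exact: val_inj | move: Ay; rewrite yz].
Qed.

(** The disc is a union of radii, which are connected and share the centre. *)
Lemma disc_connected : connected [set: disc_manifold].
Proof.
have -> : [set: disc_manifold] =
    \bigcup_(z in [set: open_disc]) disc_radius z @` `[0, 1].
  apply/seteqP; split=> // z _; exists z => //; exists 1.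
    by rewrite /= in_itv /= ler01 lexx.
  by apply: val_inj => /=; rewrite clamp_id ?ler01 ?lexx// scale1r.
apply: bigcup_connected.
  have n0 : normc (0 : R[i]) < 1 by rewrite normc0.
  exists (exist _ 0 n0) => z _; exists 0; first by rewrite /= in_itv /= ler01 lexx.
  by apply: val_inj => /=; rewrite clamp_id ?ler01 ?lexx// scale0r.
move=> z _; apply: connected_continuous_connected.
  exact: segment_connected.
exact/continuous_subspaceT/disc_radius_continuous.
Qed.

End DiscManifold.

Lemma maximum_modulus_plurisubharmonic (R : realType)
    (E : completeNormedModType R[i]) :
  strong_maximum_modulus E -> strictly_plurisubharmonic E.
Proof.
move=> mmE gamma [U [g [oU dU hg gE]]] gamma1.
have discE := @closed_unit_discE R.
suff H z : closed_unit_disc z -> gamma z = gamma 0.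
  by move=> z w zd wd; rewrite !H.
pose eta (x : disc_manifold R) : E := g (sval x).
have n0 : normc (0 : R[i]) < 1 by rewrite normc0.
pose x0 : disc_manifold R := exist _ 0 n0.
have g1 w : normc w <= 1 -> `|g w| = 1 by move=> /discE wd; rewrite gE// gamma1.
(* The norm is constantly [1], so any point, here the centre, is a local maximum. *)
have g_const w : normc w < 1 -> g w = g 0.
  move=> w1; apply: (mmE _ eta (@disc_connected R) _ _ (exist _ w w1) x0).
    move=> c ->; exists g; split=> // v [y _ <-].
    by apply/hg/dU/discE/ltW; exact: (svalP y).
  by exists x0; apply: filterE => y; rewrite /eta !g1// ltW//; exact: (svalP y).
move=> zd; rewrite -!gE//; last by apply/discE; rewrite normc0.
(* The values on the boundary are limits of values along radii. *)
apply/eqP; rewrite -subr_eq0; apply/eqP/rnorm0_eq0/eqP.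
rewrite eq_le rnorm_ge0 andbT leNgt; apply/negP => gz.
(* The tolerance is the supposed gap between [g z] and [g 0] itself: a point [t *: z] of the open
   disc near [z] has value [g 0], exactly at that distance. *)
have [d d0 gd] := differentiable_rnorm_continuous (hg _ (dU _ zd)) gz.
have [t /andP[t0 t1] td] : exists2 t : R, 0 <= t < 1 & 1 - t < d.
  by exists (1 - Num.min 1 (d / 2)); case: (leP 1 (d / 2)) => ?; lra.
have z1 := iffLR (discE z) zd.
have : rnorm (t%:C *: z - z) < d.
  rewrite -{2}[z]scale1r -scalerBl rnormZ -(rmorph1 (real_complex R)) -rmorphB.
  rewrite normc_real distrC ger0_norm ?subr_ge0 ?(ltW t1)//.
  by rewrite (le_lt_trans _ td)// ler_piMr// subr_ge0 ltW.
move=> /gd; rewrite g_const; first by rewrite rdistC ltxx.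
rewrite normcM normc_real ger0_norm// (le_lt_trans _ t1)//.
by rewrite ler_piMr.
Qed.

Theorem proposition22 (R : realType) (E : completeNormedModType (complex R)) :
  strong_maximum_modulus E <-> strictly_plurisubharmonic E.
Proof.
split; first exact: maximum_modulus_plurisubharmonic.
exact: plurisubharmonic_maximum_modulus.
Qed.
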